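(* Let $\lambda>0$ and assume that $0<p-1<q$ and $q>1$. Suppose the solution $u$ of the problem $$\begin{cases} u_t(x,t)=\Delta_{p,\omega}u(x,t)+\lambda|u(x,t)|^{q-1}u(x,t), & (x,t)\in S\times(0,\infty),\\ \mu(z)\frac{\partial u}{\partial_p n}(z,t)+\sigma(z)|u(z,t)|^{p-2}u(z,t)=0, & (z,t)\in\partial S\times[0,\infty),\\ u(x,0)=u_0(x)\ge 0, & x\in\overline S,\end{cases}$$ blows up in finite time $T$. Put $$\alpha:=\lambda^{\frac{q-p+1}{q-1}}\Big(\max_{x\in S}d_\omega x\Big)(q-1)^{\frac{2q-p}{q-1}}.$$ Then the following statements are true: (i) $\displaystyle\max_{x\in S}u(x,t)\ge\left[\lambda(q-1)(T-t)\right]^{-\frac1{q-1}}$ for $0<t<T$. (ii) $\displaystyle\max_{x\in S}u(x,t)\le\left[\lambda(q-1)(T-t)-\alpha(T-t)^{\frac{2q-p}{q-1}}\right]^{-\frac1{q-1}}$ for $0<t<T$. (iii) $\displaystyle\lim_{t\to T^-}(T-t)^{\frac1{q-1}}\max_{x\in S}u(x,t)=\left[\frac1{\lambda(q-1)}\right]^{\frac1{q-1}}$.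
   Context: Network: $G=(V,E)$ is a finite, connected, simple graph with a weight $\omega:V\times V\to[0,\infty)$, i.e. $\omega(x,x)=0$, $\omega(x,y)=\omega(y,x)$, and $\omega(x,y)>0$ iff $x\sim y$ ($x,y$ adjacent). $S$ is a connected induced subgraph of $G$ (identified with its vertex set), $\partial S=\{z\in V\setminus S: y\sim z\text{ for some }y\in S\}$, and $\overline S=S\cup\partial S$ is the network whose edges are the edges of $G$ with at least one endpoint in $S$ (so there are no edges between two vertices of $\partial S$ in $\overline S$, and $\omega$ is regarded as $0$ there). The degree of $x\in\overline S$ is $d_\omega x=\sum_{y\in\overline S}\omega(x,y)$. Operators, for $u:\overline S\to\mathbb R$, with the convention $|a|^{p-2}a=0$ if $a=0$: $\Delta_{p,\omega}u(x)=\sum_{y\in\overline S}|u(x)-u(y)|^{p-2}[u(y)-u(x)]\omega(x,y)$ for $x\in\overline S$, and $\frac{\partial u}{\partial_p n}(z)=\sum_{y\in S}|u(z)-u(y)|^{p-2}[u(z)-u(y)]\omega(z,y)$ for $z\in\partial S$. For functions of $(x,t)$ they act in the variable $x$. Boundary coefficients: $\mu,\sigma:\partial S\to[0,\infty)$ with $\mu(z)+\sigma(z)>0$ for all $z\in\partial S$. Solution: a function $u$ on $\overline S\times[0,T)$, $0<T\le\infty$, with $u(x,\cdot)$ continuous on $[0,T)$ and differentiable in $(0,T)$ for each $x\in\overline S$, satisfying the problem for times in $[0,T)$, where $[0,T)$ is a maximal interval of existence. The solution blows up in finite time $T$ $(0<T<\infty)$ if there exists $x\in S$ such that $|u(x,t)|\to+\infty$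 as $t\nearrow T^-$ (the paper states this equivalently as $\sum_{x\in S}|u(x,t)|\to+\infty$ as $t\nearrow T^-$).
   Formalization: Statement (ii) is asserted only for those 0<t<T at which the bracket λ(q-1)(T-t)-α(T-t)^{(2q-p)/(q-1)} is positive; for large T-t it can be nonpositive, and its power -1/(q-1) is then undefined or the bound false. *)

(* Defs.v *)
From HB Require Import structures.
From mathcomp Require Import all_boot all_order all_algebra.
From mathcomp Require Import all_classical all_reals all_analysis.

Set Implicit Arguments.
Unset Strict Implicit.
Unset Printing Implicit Defensive.

Import Order.TTheory GRing.Theory Num.Theory.
Import numFieldNormedType.Exports.

Local Open Scope classical_set_scope.
Local Open Scope ring_scope.

Record network (R : realType) (V : finType) := Network {
  adj : rel V;
  weight : V -> V -> R;
  adj_sym : symmetric adj;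
  adj_irr : irreflexive adj;
  adj_connected : forall x y, connect adj x y;
  weight_ge0 : forall x y, 0 <= weight x y;
  weight_diag : forall x, weight x x = 0;
  weight_sym : forall x y, weight x y = weight y x;
  weight_gt0 : forall x y, (0 < weight x y) = adj x y }.

Section Subnetwork.
Variables (R : realType) (V : finType) (G : network R V) (S : {set V}).

Definition connected_subgraph : Prop :=
  S != finset.set0 /\
  {in S &, forall x y,
    connect [rel a b | [&& a \in S, b \in S & adj G a b]] x y}.

Definition boundary : {set V} :=
  [set z | (z \notin S) && [exists y in S, adj G y z]]%SET.

Definition closed_sub : {set V} := S :|: boundary.

(* The edges between two boundary vertices are deleted, so the degree of a
   boundary vertex only counts its neighbours in S. *)
Definition subweight (x y : V) : R :=
  if (x \in S) || (y \in S) then weight G x y else 0.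

Definition degree (x : V) : R := \sum_(y in closed_sub) subweight x y.

End Subnetwork.


(* No case split is needed at equal values: powR is total, and the factor
   u y - u x vanishes there. *)
Section Operators.
Variables (R : realType) (V : finType) (G : network R V) (S : {set V}) (p : R).

Definition p_laplacian (u : V -> R) (x : V) : R :=
  \sum_(y in closed_sub G S)
    `|u x - u y| `^ (p - 2) * (u y - u x) * subweight G S x y.

Definition p_normal_derivative (u : V -> R) (z : V) : R :=
  \sum_(y in S) `|u z - u y| `^ (p - 2) * (u z - u y) * subweight G S z y.

End Operators.

(* For S nonempty, the supremum of this finite set is attained. *)
Definition max_on (R : realType) (V : finType) (S : {set V}) (f : V -> R) : R :=
  sup [set f x | x in [set` S]].

Section Problem.
Variables (R : realType) (V : finType) (G : network R V) (S : {set V}).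
Variables (p q lambda : R) (mu sigma u0 : V -> R).

(* Only the values of u on closed_sub G S and on times in [0, T[ matter;
   T = +oo is allowed. *)
Definition solves (T : \bar R) (u : V -> R -> R) : Prop :=
  [/\ {in closed_sub G S, forall x,
         {within [set t : R | 0 <= t /\ (t%:E < T)%E], continuous (u x)} /\
         forall t : R, 0 < t -> (t%:E < T)%E -> derivable (u x) t 1},
      {in S, forall x (t : R), 0 < t -> (t%:E < T)%E ->
         derive1 (u x) t = p_laplacian G S p (u^~ t) x
                       + lambda * (`|u x t| `^ (q - 1) * u x t)},
      {in boundary G S, forall z (t : R), 0 <= t -> (t%:E < T)%E ->
         mu z * p_normal_derivative G S p (u^~ t) z
         + sigma z * (`|u z t| `^ (p - 2) * u z t) = 0}
    & {in closed_sub G S, forall x, u x 0 = u0 x}].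

Definition extendable (T : \bar R) (u : V -> R -> R) : Prop :=
  exists (T' : \bar R) (v : V -> R -> R),
    [/\ (T < T')%E, solves T' v
      & {in closed_sub G S, forall x (t : R),
           0 <= t -> (t%:E < T)%E -> v x t = u x t}].

Definition is_solution (T : \bar R) (u : V -> R -> R) : Prop :=
  [/\ (0 < T)%E, solves T u & ~ extendable T u].

Definition blows_up_at (T : R) (u : V -> R -> R) : Prop :=
  is_solution T%:E u /\
  exists2 x, x \in S & `|u x t| @[t --> T^'-] --> +oo.

End Problem.

(* Main.v *)
Require Import Defs.
From mathcomp Require Import all_boot all_order all_algebra.
From mathcomp Require Import all_classical all_reals all_analysis.
From mathcomp Require Import ring lra.

Set Implicit Arguments.
Unset Strict Implicit.
Unset Printing Implicit Defensive.

Import Order.TTheory GRing.Theory Num.Theory.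
Import numFieldNormedType.Exports.

Local Open Scope classical_set_scope.
Local Open Scope ring_scope.

(** Let M(t) be the maximum of u(., t) over S.  Comparison with zero gives
    u >= 0 ([solution_nonneg]), and the boundary condition prevents u from
    exceeding M(t) on the boundary ([boundary_condition_le]), so a vertex of S
    where M(t) is attained is a maximum over the whole closed subnetwork.
    There the p-Laplacian is at most 0 and, because u >= 0, at least
    - D M^(p-1), with D the largest degree.  Informally,
      lambda M^q - D M^(p-1) <= M' <= lambda M^q,
    that is, lambda - D M^(p-1-q) <= - (M^(1-q))' / (q-1) <= lambda.

    Since M tends to infinity at T, integrating the right-hand inequality from
    t to T gives the lower bound (i) ([blow_up_lower_bound]).  By (i), and
    because p-1-q < 0, for every s in [t, T[
      M(s)^(p-1-q) <= (lambda (q-1) (T-s))^g <= (lambda (q-1) (T-t))^g,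
    where g = (q-p+1)/(q-1).  The left-hand inequality therefore integrates as
    one with the constant rate lambda - D (lambda (q-1) (T-t))^g, which gives
    (ii) with exactly the constant alpha ([blow_up_upper_bound]).  As g > 0,
    the correction term is of lower order than T-t, so (i) and (ii) squeeze
    (T-t)^(1/(q-1)) M(t) to its limit, which is (iii).

    M need not be differentiable.  The integrations are replaced by comparison
    of u with explicit functions (A + B s)^(-1/(q-1)), the solutions of
    y' = c y^q.  At the first contact of one of the finitely many functions
    u(x, .) with such a function for (i), at the last contact for (ii), the
    vertex x realises the maximum, which determines the sign of the difference
    of the two derivatives, and the equation gives the opposite sign ([first_touching_principle], [last_touching_principle]). *)

(** * Touching principles for finite families of functions *)

Lemma derive1_ge0_at_left (R : realType) (f : R -> R) (t : R) :
  derivable f t 1 -> (\forall s \near t^'-, f s <= f t) -> 0 <= derive1 f t.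
Proof.
move=> df fle; rewrite derive1E ['D_1 f t]cvg_at_leftE; last exact: df.
apply: limr_ge.
  rewrite -(cvg_at_leftE (fun h => h^-1 *: ((f \o shift t) _ - f t))) //.
  apply: cvg_trans df; apply: cvg_app.
  move=> A [e egt0 Ae]; exists e => // x xe xgt0; apply: Ae => //.
  exact/ltr0_neq0.
case: fle => e /= e0 fle.
near=> h; apply: mulr_le0.
  by rewrite invr_le0; apply: ltW; near: h; exact: nbhs_left_lt.
have h0 : h < 0 by near: h; exact: nbhs_left_lt.
rewrite subr_le0 [_%:A]mulr1; apply: fle => /=; last by rewrite gtrDr.
rewrite opprD addrCA subrr addr0 normrN ltr0_norm// ltrNl.
by near: h; apply: nbhs_left_gt; rewrite oppr_lt0.
Unshelve. all: by end_near. Qed.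

(** A replacement for differentiating the maximum of finitely many functions:
    at the earliest time when one of them reaches 0 all of them are
    nonpositive, and the one that vanishes has come from below, so its
    derivative there is nonnegative.  Only right continuity is asked at the
    initial time, where a solution need not be differentiable. *)
Lemma first_touching_principle (R : realType) (V : finType) (S : {set V})
    (f : V -> R -> R) (a b : R) :
  {in S, forall x, f x @ a^'+ --> f x a} ->
  {in S, forall x (t : R), a < t -> t <= b -> derivable (f x) t 1} ->
  {in S, forall x (t : R), a < t -> t <= b -> f x t = 0 ->
     {in S, forall y, f y t <= 0} -> derive1 (f x) t < 0} ->
  {in S, forall x, f x a < 0} ->
  {in S, forall x (t : R), a <= t -> t <= b -> f x t < 0}.
Proof.
move=> fa df touch f0 x0 x0S t0 at0 t0b; rewrite ltNge; apply/negP => fx0.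
(* The touching time s is the infimum of the times when some f x is
   nonnegative. *)
pose E := [set t : R | a <= t <= b /\ exists2 x, x \in S & 0 <= f x t].
have Et0 : E t0 by split; [rewrite at0|exists x0].
have lbE : has_lbound E by exists a => t [/andP[]].
have infE : has_inf E by split => //; exists t0.
pose s := inf E.
have as_ : a <= s by apply: lb_le_inf; [exists t0|move=> t [/andP[]]].
have sb : s <= b by apply: le_trans t0b; exact: ge_inf.
have fltE t : a <= t -> t < s -> {in S, forall x, f x t < 0}.
  move=> at_ ts x xS; rewrite ltNge; apply/negP => fxt.
  have : s <= t.
    apply: ge_inf => //; split; last by exists x.
    by rewrite at_ (le_trans (ltW ts)).
  by rewrite leNgt ts.
have cont x t : x \in S -> a < t -> t <= b -> {for t, continuous (f x)}.
  move=> xS at_ tb.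
  exact/differentiable_continuous/derivable1_diffP/df.
have [x xS fxs] : exists2 x, x \in S & 0 <= f x s.
  apply: contrapT => nex.
  have fs x : x \in S -> f x s < 0.
    by move=> xS; rewrite ltNge; apply/negP => h; apply: nex; exists x.
  have right_cont x : x \in S -> f x @ s^'+ --> f x s.
    move=> xS; move: as_; rewrite le_eqVlt => /predU1P[<-|as_]; first exact: fa.
    exact/cvg_at_right_filter/cont.
  have : \forall t \near s^'+, forall x : V, x \in S -> f x t < 0.
    apply: filter_forall => x.
    case: (boolP (x \in S)) => [xS|xnS].
      by apply: filterS (cvgr_lt _ (right_cont _ xS) _ (fs _ xS)).
    by apply: filterE.
  case=> e /= e0 near_s.
  have [t [/andP[at_ tb] [y yS fyt]] ts] := inf_adherent e0 infE.
  have st : s <= t by apply: ge_inf => //; split; [rewrite at_|exists y].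
  move: st; rewrite le_eqVlt => /predU1P[stE|st].
    by move: (fs _ yS); rewrite stE ltNge fyt.
  have : f y t < 0.
    by apply: near_s => //=; rewrite ltr0_norm ?subr_lt0// opprB ltrBlDl.
  by rewrite ltNge fyt.
have {}as_ : a < s.
  rewrite lt_neqAle as_ andbT; apply/eqP => sa.
  by move: fxs; rewrite -sa leNgt f0.
have before : \forall t \near s^'-, {in S, forall y, f y t < 0}.
  near=> t; apply: fltE; first by near: t; exact: nbhs_left_ge.
  by near: t; exact: nbhs_left_lt.
have fle y : y \in S -> f y s <= 0.
  move=> yS.
  have fys : f y t @[t --> s^'-] --> f y s by exact/cvg_at_left_filter/cont.
  apply: (cvgr_to_le fys).
  by apply: filterS before => t h; exact/ltW/h.
have fxs0 : f x s = 0 by apply/le_anti; rewrite fle.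
have := touch x xS s as_ sb fxs0 fle.
rewrite ltNge derive1_ge0_at_left //; first exact: df.
by rewrite fxs0; apply: filterS before => t h; exact/ltW/h.
Unshelve. all: by end_near. Qed.

(** The time reversal of the previous principle.  It is the one suited to upper
    bounds on a maximum: forward in time nothing prevents the maximum from
    passing to another vertex, so a vertex where a lower barrier is met may
    have lain far below the barrier just before, whereas going backwards every
    vertex lies below the barrier until the meeting time. *)
Lemma last_touching_principle (R : realType) (V : finType) (S : {set V})
    (f : V -> R -> R) (a b : R) :
  {in S, forall x (t : R), a <= t -> t <= b -> derivable (f x) t 1} ->
  {in S, forall x (t : R), a <= t -> t < b -> f x t = 0 ->
     {in S, forall y, f y t <= 0} -> 0 < derive1 (f x) t} ->
  {in S, forall x, f x b < 0} ->
  {in S, forall x (t : R), a <= t -> t <= b -> f x t < 0}.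
Proof.
move=> df touch fb x xS t at_ tb.
pose g y s := f y (- s).
have dg y s : y \in S -> - b <= s -> s <= - a ->
    is_derive s 1 (g y) (derive1 (f y) (- s) * -1).
  move=> yS bs sa; apply: (@is_derive1_comp _ (f y) -%R).
  rewrite derive1E; apply/derivableP/df => //; first by rewrite lerNr.
  by rewrite lerNl.
have -> : f x t = g x (- t) by rewrite /g opprK.
apply: (@first_touching_principle _ _ S g (- b) (- a)) => //.
- move=> y yS; apply/cvg_at_right_filter/differentiable_continuous.
  apply/derivable1_diffP.
  have ba : - b <= - a by rewrite lerN2 (le_trans at_).
  by have [] := dg y (- b) yS (lexx _) ba.
- move=> y yS s bs sa.
  by have [] := dg y s yS (ltW bs) sa.
- move=> y yS s bs sa gys0 gle.
  have [_] := dg y s yS (ltW bs) sa.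
  rewrite -derive1E => ->; rewrite mulrN1 oppr_lt0.
  by apply: touch => //; [rewrite lerNr|rewrite ltrNl].
- by move=> y yS; rewrite /g opprK fb.
- by rewrite lerN2.
- by rewrite lerN2.
Qed.

(** * Extrema of the discrete p-Laplacian and the boundary condition *)

(** At a = 0 the identity relies on p <> 1: both sides are then 0, even when
    p = 2 and the first factor is 1. *)
Lemma powR_subr2_mul (R : realType) (a p : R) :
  0 <= a -> 0 < p - 1 -> a `^ (p - 2) * a = a `^ (p - 1).
Proof.
move=> a0 p1; rewrite mulrC -(mulr_powRB1 a0 p1); congr (_ * _ `^ _).
by rewrite -addrA -opprD.
Qed.

Lemma subweight_ge0 (R : realType) (V : finType) (G : network R V)
    (S : {set V}) (x y : V) : 0 <= subweight G S x y.
Proof. by rewrite /subweight; case: ifP => // _; exact: weight_ge0. Qed.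

Lemma p_laplacianN (R : realType) (V : finType) (G : network R V)
    (S : {set V}) (p : R) (v : V -> R) (x : V) :
  p_laplacian G S p (fun y => - v y) x = - p_laplacian G S p v x.
Proof.
rewrite /p_laplacian -sumrN; apply: eq_bigr => y _.
by rewrite -opprD normrN -opprD mulrN mulNr.
Qed.

Lemma p_normal_derivativeN (R : realType) (V : finType) (G : network R V)
    (S : {set V}) (p : R) (v : V -> R) (z : V) :
  p_normal_derivative G S p (fun y => - v y) z = - p_normal_derivative G S p v z.
Proof.
rewrite /p_normal_derivative -sumrN; apply: eq_bigr => y _.
by rewrite -opprD normrN mulrN mulNr.
Qed.

Lemma p_laplacian_max_le0 (R : realType) (V : finType) (G : network R V)
    (S : {set V}) (p : R) (v : V -> R) (x : V) :
  {in closed_sub G S, forall y, v y <= v x} -> p_laplacian G S p v x <= 0.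
Proof.
move=> vmax; apply: sumr_le0 => y yS.
rewrite mulr_le0_ge0 ?subweight_ge0// mulr_ge0_le0 ?powR_ge0//.
by rewrite subr_le0 vmax.
Qed.

(** For nonnegative v the differences v x - v y lie between 0 and v x. *)
Lemma p_laplacian_max_ge (R : realType) (V : finType) (G : network R V)
    (S : {set V}) (p : R) (v : V -> R) (x : V) :
  0 < p - 1 -> {in closed_sub G S, forall y, 0 <= v y} ->
  {in closed_sub G S, forall y, v y <= v x} ->
  - (degree G S x * v x `^ (p - 1)) <= p_laplacian G S p v x.
Proof.
move=> p1 v0 vmax; rewrite /degree mulr_suml -sumrN; apply: ler_sum => y yS.
have yx := vmax y yS; have y0 := v0 y yS.
rewrite -(opprB (v x) (v y)) mulrN mulNr lerN2 [leLHS]mulrC ler_wpM2l ?subweight_ge0//.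
rewrite ger0_norm ?subr_ge0// powR_subr2_mul ?subr_ge0//.
apply: ge0_ler_powR; rewrite ?nnegrE ?subr_ge0 ?gerBl//.
  by rewrite -subr_ge0; exact: ltW.
exact: le_trans yx.
Qed.

(** If v z exceeded every value on S and c >= 0, all terms of the normal
    derivative would be nonnegative, and positive for a neighbour of z in S
    (one exists because z is a boundary vertex); the absorption term would be
    positive too, so the two could not cancel. *)
Lemma boundary_condition_le (R : realType) (V : finType) (G : network R V)
    (S : {set V}) (p mu sigma c : R) (v : V -> R) (z : V) :
  z \in boundary G S -> 0 <= mu -> 0 <= sigma -> 0 < mu + sigma -> 0 <= c ->
  {in S, forall y, v y <= c} ->
  mu * p_normal_derivative G S p v z + sigma * (`|v z| `^ (p - 2) * v z) = 0 ->
  v z <= c.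
Proof.
rewrite inE => /andP[znS /exists_inP[y0 y0S adjy0z]] mu0 sigma0 musigma c0 vc bc.
rewrite leNgt; apply/negP => cz.
have vz0 : 0 < v z by exact: le_lt_trans cz.
have sz : 0 < `|v z| `^ (p - 2) * v z.
  by rewrite mulr_gt0// powR_gt0// gtr0_norm.
have zy y : y \in S -> 0 < v z - v y.
  by move=> yS; rewrite subr_gt0 (le_lt_trans (vc _ yS)).
have nz : 0 < p_normal_derivative G S p v z.
  rewrite /p_normal_derivative (bigD1 y0)//= ltr_pwDl//.
    rewrite !mulr_gt0 ?powR_gt0 ?normr_gt0 ?lt0r_neq0 ?zy//.
    by rewrite /subweight y0S orbT weight_gt0 adj_sym.
  apply: sumr_ge0 => y /andP[yS _].
  by rewrite !mulr_ge0 ?powR_ge0 ?subweight_ge0 ?ltW ?zy.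
have : 0 < mu * p_normal_derivative G S p v z
           + sigma * (`|v z| `^ (p - 2) * v z).
  move: mu0; rewrite le_eqVlt => /predU1P[mu00|mu0].
    by rewrite -mu00 mul0r add0r mulr_gt0//; move: musigma; rewrite -mu00 add0r.
  by rewrite ltr_pwDl// ?mulr_gt0// mulr_ge0// ltW.
by rewrite bc ltxx.
Qed.

(** * Comparison and nonnegativity *)

(** The operators and the reaction term are odd, so lower bounds on solutions
    follow from upper bounds. *)
Lemma solvesN (R : realType) (V : finType) (G : network R V) (S : {set V})
    (p q lambda : R) (mu sigma u0 : V -> R) (T : \bar R) (u : V -> R -> R) :
  solves G S p q lambda mu sigma u0 T u ->
  solves G S p q lambda mu sigma (fun x => - u0 x) T (fun x t => - u x t).
Proof.
case=> reg pde bc ic; split=> [x xS|x xS t t0 tT|z zS t t0 tT|x xS].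
- have [cu du] := reg x xS; split=> [t|t t0 tT]; first exact/continuousN/cu.
  exact/derivableN/du.
- have xc : x \in closed_sub G S by rewrite finset.in_setU xS.
  have [_ du] := reg x xc.
  rewrite derive1E deriveN; last exact: du.
  rewrite -derive1E pde// p_laplacianN normrN opprD; congr (_ + _).
  by rewrite !mulrN.
- by rewrite p_normal_derivativeN normrN !mulrN -opprD bc// oppr0.
- by rewrite ic.
Qed.

Lemma solves_cvg_at_right (R : realType) (V : finType) (G : network R V)
    (S : {set V}) (p q lambda : R) (mu sigma u0 : V -> R) (T a : R)
    (u : V -> R -> R) (x : V) :
  solves G S p q lambda mu sigma u0 T%:E u -> x \in S -> 0 <= a -> a < T ->
  u x @ a^'+ --> u x a.
Proof.
case=> reg _ _ _ xS a0 aT.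
have [|+ _] := reg x; first by rewrite finset.in_setU xS.
move=> /subspace_continuousP/(_ a) cu.
apply: cvg_trans (cu _); last by split=> //; rewrite lte_fin.
apply: cvg_app => A -[e /= e0 eA].
near=> t; apply: eA => /=.
  rewrite ltr0_norm ?subr_lt0; last by near: t; exact: nbhs_right_gt.
  by rewrite opprB ltrBlDl; near: t; apply: nbhs_right_lt; rewrite ltrDl.
- split; first by apply: le_trans a0 _; near: t; exact: nbhs_right_ge.
  by rewrite lte_fin; near: t; exact: nbhs_right_lt.
Unshelve. all: by end_near. Qed.

Lemma solves_derivable (R : realType) (V : finType) (G : network R V)
    (S : {set V}) (p q lambda : R) (mu sigma u0 : V -> R) (T t : R)
    (u : V -> R -> R) (x : V) :
  solves G S p q lambda mu sigma u0 T%:E u -> x \in S -> 0 < t -> t < T ->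
  derivable (u x) t 1.
Proof.
case=> reg _ _ _ xS t0 tT.
have [|_ du] := reg x; first by rewrite finset.in_setU xS.
by apply: du; rewrite ?lte_fin.
Qed.

Lemma solution_max_closed (R : realType) (V : finType) (G : network R V)
    (S : {set V}) (p q lambda : R) (mu sigma u0 : V -> R) (T t c : R)
    (u : V -> R -> R) :
  {in boundary G S, forall z, 0 <= mu z} ->
  {in boundary G S, forall z, 0 <= sigma z} ->
  {in boundary G S, forall z, 0 < mu z + sigma z} ->
  solves G S p q lambda mu sigma u0 T%:E u -> 0 <= t -> t < T -> 0 <= c ->
  {in S, forall x, u x t <= c} -> {in closed_sub G S, forall x, u x t <= c}.
Proof.
move=> mu0 sigma0 musigma [_ _ bc _] t0 tT c0 uc x.
rewrite finset.in_setU => /orP[/uc//|xb].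
apply: (boundary_condition_le xb (mu0 _ xb) (sigma0 _ xb) (musigma _ xb) c0 uc).
by apply: bc; rewrite ?lte_fin.
Qed.

(** A function of time alone is annihilated by the p-Laplacian, so it is a strict
    supersolution as soon as it beats the reaction term.  At a first contact
    the vertex is a maximum over the closed subnetwork and the diffusion can
    only slow u down. *)
Lemma supersolution_comparison (R : realType) (V : finType) (G : network R V)
    (S : {set V}) (p q lambda : R) (mu sigma u0 : V -> R) (T a b : R)
    (u : V -> R -> R) (phi : R -> R) :
  {in boundary G S, forall z, 0 <= mu z} ->
  {in boundary G S, forall z, 0 <= sigma z} ->
  {in boundary G S, forall z, 0 < mu z + sigma z} ->
  solves G S p q lambda mu sigma u0 T%:E u -> 0 <= a -> b < T ->
  (forall t, a <= t -> t <= b ->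
     [/\ 0 <= phi t, derivable phi t 1
       & lambda * (phi t `^ (q - 1) * phi t) < derive1 phi t]) ->
  {in S, forall x, u x a < phi a} ->
  {in S, forall x (t : R), a <= t -> t <= b -> u x t < phi t}.
Proof.
move=> mu0 sigma0 musigma su a0 bT hphi ua x xS t at_ tb; rewrite -subr_lt0.
have ab : a <= b by exact: le_trans tb.
have aT : a < T by exact: le_lt_trans bT.
pose f x t := u x t - phi t.
have df y s : y \in S -> a < s -> s <= b -> derivable (u y) s 1.
  move=> yS as_ sb; apply: (solves_derivable su) => //.
    exact: le_lt_trans as_.
  exact: le_lt_trans bT.
have dphi s : a <= s -> s <= b -> derivable phi s 1.
  by move=> as_ sb; have [] := hphi s as_ sb.
apply: (@first_touching_principle _ _ S f a b) => //.
- move=> y yS; apply: cvgB; first exact: (solves_cvg_at_right su).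
  apply/cvg_at_right_filter/differentiable_continuous/derivable1_diffP.
  exact: dphi.
- by move=> y yS s as_ sb; apply: derivableB; [exact: df|exact/dphi/sb/ltW].
- move=> y yS s as_ sb fys0 fle.
  have [phi0 _ phi'] := hphi s (ltW as_) sb.
  have sT : s < T by exact: le_lt_trans bT.
  have s0 : 0 < s by exact: le_lt_trans as_.
  have uphi : u y s = phi s by apply/eqP; rewrite -subr_eq0; apply/eqP.
  rewrite derive1E deriveB; [|exact: df|exact/dphi/sb/ltW].
  rewrite -!derive1E subr_lt0; apply: le_lt_trans phi'.
  have [_ pde _ _] := su; rewrite pde ?lte_fin// uphi ger0_norm// gerDr.
  apply: p_laplacian_max_le0 => z zc /=; rewrite uphi.
  apply: (solution_max_closed mu0 sigma0 musigma su (ltW s0)) zc => //.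
  by move=> w wS; rewrite -subr_le0; exact: fle.
- by move=> y yS; rewrite subr_lt0 ua.
Qed.

(** The function - u is compared with the supersolution k exp(lambda t): as
    long as this is below 1, its growth rate lambda exceeds that of the
    reaction term because q > 1.  Then k tends to 0. *)
Lemma solution_nonneg (R : realType) (V : finType) (G : network R V)
    (S : {set V}) (p q lambda : R) (mu sigma u0 : V -> R) (T : R)
    (u : V -> R -> R) :
  {in boundary G S, forall z, 0 <= mu z} ->
  {in boundary G S, forall z, 0 <= sigma z} ->
  {in boundary G S, forall z, 0 < mu z + sigma z} ->
  0 < lambda -> 1 < q -> {in closed_sub G S, forall x, 0 <= u0 x} ->
  solves G S p q lambda mu sigma u0 T%:E u ->
  forall t, 0 <= t -> t < T -> {in closed_sub G S, forall x, 0 <= u x t}.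
Proof.
move=> mu0 sigma0 musigma lambda0 q1 u00 su t t0 tT.
have suN := solvesN su.
suff uS : {in S, forall x, - u x t <= 0}.
  move=> x xc; rewrite -oppr_le0.
  exact: (solution_max_closed mu0 sigma0 musigma suN t0 tT (lexx 0) uS).
move=> x xS; apply/ler_addgt0Pl => e e0; rewrite addr0.
(* k makes k exp(lambda s) at most e and below 1 for all s up to t. *)
pose k := Num.min (e / expR (lambda * t)) (2^-1 / expR (lambda * t)).
have k0 : 0 < k by rewrite lt_min !divr_gt0 ?expR_gt0.
pose phi s := k * expR (lambda * s).
have phi0 s : 0 < phi s by rewrite mulr_gt0// expR_gt0.
have dphi (s : R) : is_derive s 1 phi (lambda * phi s).
  rewrite /phi; apply: is_derive_eq.
  by rewrite /GRing.scale/= ?scaler0 ?mulr1 ?addr0; ring.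
have phile s : s <= t -> phi s <= phi t.
  by move=> st; rewrite ler_pM2l// ler_expR ler_pM2l.
have phit1 : phi t < 1.
  rewrite /phi -ltr_pdivlMr ?expR_gt0//.
  apply: (@le_lt_trans _ _ (2^-1 / expR (lambda * t))).
    by rewrite ge_min lexx orbT.
  by rewrite ltr_pM2r ?invr_gt0 ?expR_gt0// invf_lt1// ltr1n.
have phie : phi t <= e.
  by rewrite /phi -ler_pdivlMr ?expR_gt0// ge_min lexx.
apply/ltW/(lt_le_trans _ phie).
apply: (supersolution_comparison mu0 sigma0 musigma suN (lexx 0) tT) xS _ t0 (lexx t).
- move=> s s0 st; split; first exact: ltW.
    by case: (dphi s).
  rewrite derive1E; have [_ ->] := dphi s; rewrite ltr_pM2l// gtr_pMl//.
  have phis1 : phi s < 1 := le_lt_trans (phile s st) phit1.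
  have := @gt0_ltr_powR _ (q - 1) _ (phi s) 1.
  by rewrite powR1; apply; rewrite ?subr_gt0 ?nnegrE// ltW.
- move=> y yS; have [_ _ _ ic] := su.
  have yc : y \in closed_sub G S by rewrite finset.in_setU yS.
  by apply: le_lt_trans (phi0 0); rewrite ic// oppr_le0 u00.
Qed.

(** * Power barriers and the lower bound on the blow-up rate *)

Lemma powRN_antitone (R : realType) (r x y : R) :
  0 <= r -> 0 < x -> x <= y -> y `^ (- r) <= x `^ (- r).
Proof.
move=> r0 x0 xy; have y0 : 0 < y by exact: lt_le_trans xy.
rewrite !powRN lef_pV2 ?posrE ?powR_gt0//.
by apply: ge0_ler_powR; rewrite ?nnegrE// ltW.
Qed.

Lemma continuous_powR_pos (R : realType) (r x : R) :
  0 < x -> y `^ r @[y --> x] --> x `^ r.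
Proof.
move=> x0.
have : differentiable (fun y : R => y `^ r) x; last exact: differentiable_continuous.
apply/derivable1_diffP.
by apply: derivable_powR; rewrite in_itv/= x0.
Qed.

(** These are the solutions of phi' = - B / (q - 1) * phi^q, with phi^q written
    in the form of the reaction term. *)
Lemma is_derive_power_barrier (R : realType) (q A B t : R) :
  1 < q -> 0 < A + B * t ->
  let phi s := (A + B * s) `^ (- (1 / (q - 1))) in
  is_derive t 1 phi (- (B / (q - 1)) * (phi t `^ (q - 1) * phi t)).
Proof.
move=> q1 ABt phi.
have q0 : q - 1 != 0 by rewrite gt_eqF// subr_gt0.
have dAB : is_derive t 1 (fun s => A + B * s) B.
  by apply: is_derive_eq; rewrite /GRing.scale/= ?scaler0; ring.
have dphi := @is_derive1_comp R (fun x : R => x `^ (- (1 / (q - 1)))) (fun s => A + B * s)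
  t _ _ (is_derive1_powR _ ABt) dAB.
apply: (is_derive_eq dphi).
have e1 : - (1 / (q - 1)) * (q - 1) = -1 by rewrite mulNr div1r mulVf.
by rewrite /phi -powRrM e1 powRD ?(gt_eqF ABt) ?implybT//; ring.
Qed.

(** If every u y t were below the value at t of the solution of y' = lambda y^q
    that explodes at T, then a barrier that solves a slightly faster equation
    but explodes later than T would keep u bounded up to T. *)
Lemma blow_up_lower_bound (R : realType) (V : finType) (G : network R V)
    (S : {set V}) (p q lambda : R) (mu sigma u0 : V -> R) (T t : R)
    (u : V -> R -> R) (x : V) :
  {in boundary G S, forall z, 0 <= mu z} ->
  {in boundary G S, forall z, 0 <= sigma z} ->
  {in boundary G S, forall z, 0 < mu z + sigma z} ->
  0 < lambda -> 1 < q ->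
  solves G S p q lambda mu sigma u0 T%:E u ->
  (forall t, 0 <= t -> t < T -> {in closed_sub G S, forall x, 0 <= u x t}) ->
  x \in S -> `|u x t| @[t --> T^'-] --> +oo ->
  0 <= t -> t < T ->
  exists2 y, y \in S & (lambda * (q - 1) * (T - t)) `^ (- (1 / (q - 1))) <= u y t.
Proof.
move=> mu0 sigma0 musigma lambda0 q1 su u0_ xS blowup t0 tT.
apply: contrapT => nex; set A0 := lambda * (q - 1) * (T - t) in nex.
have q0 : 0 < q - 1 by rewrite subr_gt0.
have Tt : 0 < T - t by rewrite subr_gt0.
have A00 : 0 < A0 by rewrite !mulr_gt0.
have uA0 y : y \in S -> u y t < A0 `^ (- (1 / (q - 1))).
  by move=> yS; rewrite ltNge; apply/negP => h; apply: nex; exists y.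
(* By continuity the strict bound survives with some a > A0; the gap a - A0
   pays for the slope B exceeding lambda (q - 1). *)
have [a [aA0 ua]] : exists a, A0 < a /\
    {in S, forall y, u y t < a `^ (- (1 / (q - 1)))}.
  have ua : \forall a \near A0^'+, forall y : V, y \in S ->
      u y t < a `^ (- (1 / (q - 1))).
    apply: filter_forall => y.
    case: (boolP (y \in S)) => yS; last exact: filterE.
    have cA0 : a `^ (- (1 / (q - 1))) @[a --> A0^'+] --> A0 `^ (- (1 / (q - 1))).
      exact/cvg_at_right_filter/continuous_powR_pos.
    by apply: filterS (cvgr_gt _ cA0 _ (uA0 _ yS)).
  have [a [aA0 {}ua]] := filter_ex (filterI (nbhs_right_gt A0) ua).
  by exists a.
pose B := (A0 + a) / 2 / (T - t).
have BTt : B * (T - t) = (A0 + a) / 2 by rewrite mulfVK// gt_eqF.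
have Blambda : lambda * (q - 1) < B.
  by rewrite -(ltr_pM2r Tt) BTt -/A0; lra.
have B0 : 0 < B by apply: lt_trans Blambda; rewrite mulr_gt0.
pose phi s := (a + B * t + - B * s) `^ (- (1 / (q - 1))).
(* m is the value of the affine function inside phi at time T. *)
pose m := (a - A0) / 2.
have m0 : 0 < m by rewrite /m; lra.
have mle s : s <= T -> m <= a + B * t + - B * s.
  move=> sT; have : B * (T - s) >= 0 by rewrite mulr_ge0 ?subr_ge0// ltW.
  rewrite mulrBr; move: BTt; rewrite mulrBr /m; lra.
have phim s : s <= T -> phi s <= m `^ (- (1 / (q - 1))).
  by move=> sT; apply: powRN_antitone (mle s sT) => //; rewrite divr_ge0 ?ltW.
have ult s : t <= s -> s < T -> u x s < phi s.
  move=> ts sT.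
  apply: (supersolution_comparison mu0 sigma0 musigma su t0 sT) xS _ ts (lexx s).
  - move=> r tr rs; have rT : r <= T by exact/ltW/le_lt_trans/sT.
    have pos : 0 < a + B * t + - B * r := lt_le_trans m0 (mle r rT).
    have [dphi phi'] := is_derive_power_barrier q1 pos.
    split; [exact: powR_ge0|exact: dphi|].
    rewrite derive1E [X in _ < X]phi' -/(phi r).
    have -> : - (- B / (q - 1)) = B / (q - 1) by rewrite mulNr opprK.
    rewrite ltr_pM2r ?mulr_gt0 ?powR_gt0//.
    by rewrite ltr_pdivlMr.
  - move=> y yS; have -> : phi t = a `^ (- (1 / (q - 1))); last exact: ua.
    by congr (_ `^ _); ring.
have /cvgryPge/(_ (m `^ (- (1 / (q - 1))))) big := blowup.
have : \forall s \near T^'-, False.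
  near=> s.
  have ts : t <= s by near: s; exact: nbhs_left_ge.
  have sT : s < T by near: s; exact: nbhs_left_lt.
  have : m `^ (- (1 / (q - 1))) <= `|u x s| by near: s.
  rewrite ger0_norm; last first.
    by apply: u0_ => //; [exact: le_trans ts|rewrite finset.in_setU xS].
  by rewrite leNgt (lt_le_trans (ult s ts sT))// phim// ltW.
by move=> /filter_ex[].
Unshelve. all: by end_near. Qed.

(** * The upper bound on the blow-up rate *)

Lemma solution_derive_ge_at_max (R : realType) (V : finType) (G : network R V)
    (S : {set V}) (p q lambda D : R) (mu sigma u0 : V -> R) (T t : R)
    (u : V -> R -> R) (x : V) :
  {in boundary G S, forall z, 0 <= mu z} ->
  {in boundary G S, forall z, 0 <= sigma z} ->
  {in boundary G S, forall z, 0 < mu z + sigma z} ->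
  0 < p - 1 -> {in S, forall y, degree G S y <= D} ->
  solves G S p q lambda mu sigma u0 T%:E u -> 0 < t -> t < T ->
  {in closed_sub G S, forall y, 0 <= u y t} ->
  x \in S -> {in S, forall y, u y t <= u x t} ->
  lambda * (u x t `^ (q - 1) * u x t) - D * u x t `^ (p - 1)
    <= derive1 (u x) t.
Proof.
move=> mu0 sigma0 musigma p1 hD su t0 tT u0_ xS umax.
have xc : x \in closed_sub G S by rewrite finset.in_setU xS.
have [_ pde _ _] := su; rewrite pde ?lte_fin// ger0_norm ?u0_// addrC lerD2r.
have maxc : {in closed_sub G S, forall y, u y t <= u x t}.
  exact: (solution_max_closed mu0 sigma0 musigma su (ltW t0) tT (u0_ _ xc)).
apply: le_trans (p_laplacian_max_ge p1 u0_ maxc).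
by rewrite lerN2 ler_wpM2r ?powR_ge0// hD.
Qed.

(** By the lower bound, on [t, T[ the diffusion loss D M^(p-1) is at most
    D (lambda (q-1) (T-t))^((q-p+1)/(q-1)) times M^q.  So from any vertex
    exceeding the claimed bound at time t the maximum would grow at least like
    the solution of y' = beta y^q, and would explode before T.  This is made
    precise backwards from a time b < T at which u is finite. *)
Lemma blow_up_upper_bound (R : realType) (V : finType) (G : network R V)
    (S : {set V}) (p q lambda D : R) (mu sigma u0 : V -> R) (T t : R)
    (u : V -> R -> R) (x : V) :
  {in boundary G S, forall z, 0 <= mu z} ->
  {in boundary G S, forall z, 0 <= sigma z} ->
  {in boundary G S, forall z, 0 < mu z + sigma z} ->
  0 < lambda -> 0 < p - 1 -> p - 1 < q -> 1 < q ->
  0 <= D -> {in S, forall y, degree G S y <= D} ->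
  solves G S p q lambda mu sigma u0 T%:E u ->
  (forall t, 0 <= t -> t < T -> {in closed_sub G S, forall x, 0 <= u x t}) ->
  x \in S -> `|u x t| @[t --> T^'-] --> +oo ->
  0 < t -> t < T ->
  let beta := lambda
    - D * (lambda * (q - 1) * (T - t)) `^ ((q - p + 1) / (q - 1)) in
  0 < beta ->
  {in S, forall y,
    u y t <= ((q - 1) * beta * (T - t)) `^ (- (1 / (q - 1)))}.
Proof.
move=> mu0 sigma0 musigma lambda0 p1 pq q1 D0 hD su u0_ xS blowup t0 tT.
set Y := lambda * (q - 1) * (T - t) => beta beta0 y yS.
have q0 : 0 < q - 1 by rewrite subr_gt0.
have Tt : 0 < T - t by rewrite subr_gt0.
have Y0 : 0 < Y by rewrite !mulr_gt0.
set e := - (1 / (q - 1)).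
have e1 : e * (q - 1) = -1 by rewrite /e mulNr div1r mulVf// gt_eqF.
have e0 : 0 <= 1 / (q - 1) by rewrite divr_ge0// ltW.
pose X := (q - 1) * beta * (T - t).
have X0 : 0 < X by rewrite !mulr_gt0.
rewrite leNgt -/X; apply/negP => Xu.
have [a [aX ua a0]] : exists a, [/\ a < X, a `^ e < u y t & 0 < a].
  have cX : a `^ e @[a --> X^'-] --> X `^ e.
    exact/cvg_at_left_filter/continuous_powR_pos.
  have [a [aX [ua a0]]] := filter_ex (filterI (nbhs_left_lt X)
    (filterI (cvgr_lt _ cX _ Xu) (nbhs_left_gt X0))).
  by exists a.
(* One factor r slows the barrier down, the other moves its final time b
   before T; r^2 X >= a leaves the barrier below u y at time t. *)
pose r := (1 + a / X) / 2.
have aX1 : a / X < 1 by rewrite ltr_pdivrMr// mul1r.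
have aX0 : 0 < a / X by rewrite divr_gt0.
have r0 : 0 < r by rewrite /r divr_gt0// addr_gt0.
have r1 : r < 1 by rewrite /r; lra.
have raX : a <= r * r * X.
  rewrite -ler_pdivrMr//.
  have : 0 <= (1 - a / X) ^+ 2 by rewrite sqr_ge0.
  by rewrite /r expr2; nra.
pose k := (q - 1) * beta * r.
have k0 : 0 < k := mulr_gt0 (mulr_gt0 q0 beta0) r0.
pose b := t + r * (T - t).
have tb : t < b by rewrite ltrDl; exact: mulr_gt0.
have bT : b < T by rewrite /b -ltrBrDl gtr_pMl.
have kbt : k * (b - t) = r * r * X by rewrite /k /b /X; ring.
have b0 : 0 < b by exact: lt_trans tb.
(* L exceeds all values of u at time b, and rho is chosen so that phi b = L. *)
pose L := 1 + \sum_(z in S) u z b.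
have ub z : z \in S -> 0 <= u z b.
  by move=> zS; apply: u0_ => //; [exact: ltW|rewrite finset.in_setU zS].
have uL z : z \in S -> u z b < L.
  move=> zS; rewrite /L (bigD1 z)//= addrCA ltrDl ltr_pwDl//.
  by apply: sumr_ge0 => w /andP[wS _]; exact: ub.
have L0 : 0 < L by rewrite /L ltr_pwDl// sumr_ge0.
pose rho := L `^ (- (q - 1)).
have rho0 : 0 < rho by rewrite powR_gt0.
have rhoe : rho `^ e = L.
  by rewrite /rho -powRrM mulNr mulrC e1 opprK powRr1// ltW.
pose phi s := (rho + k * b + - k * s) `^ e.
have pos s : s <= b -> rho <= rho + k * b + - k * s.
  by move=> sb; rewrite -addrA lerDl mulNr subr_ge0 ler_pM2l.
have dphi s : s <= b ->
    is_derive s 1 phi (k / (q - 1) * (phi s `^ (q - 1) * phi s)).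
  move=> sb; have := is_derive_power_barrier q1 (lt_le_trans rho0 (pos s sb)).
  rewrite /= -/e -/(phi s).
  by have -> : - (- k / (q - 1)) = k / (q - 1) by rewrite mulNr opprK.
pose f z s := u z s - phi s.
suff : f y t < 0.
  rewrite subr_lt0 ltNge => /negP; apply; apply/ltW/(le_lt_trans _ ua).
  apply: powRN_antitone => //; apply: le_trans raX _.
  by rewrite -kbt; lra.
apply: (@last_touching_principle _ _ S f t b) yS _ _ _ => //; last exact: ltW.
- move=> z zS s ts sb; apply: derivableB; last by case: (dphi s sb).
  by apply: (solves_derivable su) => //; [exact: lt_le_trans ts|exact: le_lt_trans bT].
- move=> z zS s ts sb fzs0 fle.
  have s0 : 0 < s by exact: lt_le_trans ts.
  have sT : s < T by exact: lt_trans bT.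
  have uphi : u z s = phi s by apply/eqP; rewrite -subr_eq0; apply/eqP.
  have phi0 : 0 < phi s.
    by rewrite powR_gt0// (lt_le_trans rho0)// pos// ltW.
  have umax : {in S, forall w, u w s <= u z s}.
    by move=> w wS; rewrite uphi -subr_le0; exact: fle.
  have du : derivable (u z) s 1 by exact: (solves_derivable su).
  have [dphis phi'] := dphi s (ltW sb).
  rewrite derive1E deriveB// phi' subr_gt0 -derive1E.
  have := solution_derive_ge_at_max mu0 sigma0 musigma p1 hD su s0 sT
    (u0_ s (ltW s0) sT) zS umax.
  rewrite uphi; apply: lt_le_trans.
  set P := phi s `^ (q - 1) * phi s.
  have P0 : 0 < P by rewrite mulr_gt0// powR_gt0.
  have kbeta : k / (q - 1) < beta.
    by rewrite ltr_pdivrMr// /k [ltRHS]mulrC gtr_pMr// mulr_gt0.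
  apply: (@lt_le_trans _ _ (beta * P)); first by rewrite ltr_pM2r.
  rewrite /beta mulrBl lerD2l lerN2 -mulrA ler_wpM2l//.
  have phiY : Y `^ e <= phi s.
    have [w wS lw] := blow_up_lower_bound mu0 sigma0 musigma lambda0 q1 su u0_
      xS blowup (ltW s0) sT.
    rewrite -uphi; apply: le_trans (umax w wS); apply: le_trans lw.
    apply: powRN_antitone => //; first by rewrite !mulr_gt0// subr_gt0.
    by rewrite ler_pM2l ?mulr_gt0// lerD2l lerN2.
  (* The loss relative to the reaction: phi^(p-1) = phi^(p-1-q) phi^q. *)
  have -> : phi s `^ (p - 1) = phi s `^ (- (q - p + 1)) * P.
    rewrite /P [_ * phi s]mulrC mulr_powRB1 ?(ltW phi0)//; last exact: lt_trans q1.
    rewrite -powRD ?(gt_eqF phi0) ?implybT//.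
    by congr (_ `^ _); ring.
  rewrite ler_wpM2r ?(ltW P0)//.
  have -> : Y `^ ((q - p + 1) / (q - 1)) = (Y `^ e) `^ (- (q - p + 1)).
    by rewrite -powRrM; congr (_ `^ _); rewrite /e; ring.
  apply: powRN_antitone => //; last exact: powR_gt0.
  by lra.
- move=> z zS; rewrite subr_lt0 (lt_le_trans (uL z zS))// -rhoe /phi.
  by rewrite mulNr addrK.
Qed.

(** * Blow-up rate of the maximum *)

Lemma le_max_on (R : realType) (V : finType) (S : {set V}) (f : V -> R) (x : V) :
  x \in S -> f x <= max_on S f.
Proof.
move=> xS; apply: ub_le_sup; last by exists x.
exists (\sum_(y in S) `|f y|) => _ [y yS <-].
apply: le_trans (ler_norm _) _; rewrite (bigD1 y)//= lerDl.
exact: sumr_ge0.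
Qed.

Lemma max_on_le (R : realType) (V : finType) (S : {set V}) (f : V -> R) (c : R) :
  S != finset.set0 -> {in S, forall x, f x <= c} -> max_on S f <= c.
Proof.
move=> /set0Pn[x xS] fc; apply: ge_sup; first by exists (f x), x.
by move=> _ [y yS <-]; exact: fc.
Qed.

Theorem theorem3p7 (R : realType) (V : finType) (G : network R V) (S : {set V})
    (hS : connected_subgraph G S)
    (mu sigma : V -> R)
    (hmu : {in boundary G S, forall z, 0 <= mu z})
    (hsigma : {in boundary G S, forall z, 0 <= sigma z})
    (hmusigma : {in boundary G S, forall z, 0 < mu z + sigma z})
    (lambda p q : R)
    (hlambda : 0 < lambda) (hp : 0 < p - 1) (hpq : p - 1 < q) (hq : 1 < q)
    (u0 : V -> R) (hu0 : {in closed_sub G S, forall x, 0 <= u0 x})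
    (T : R) (u : V -> R -> R)
    (hu : blows_up_at G S p q lambda mu sigma u0 T u) :
  let alpha := lambda `^ ((q - p + 1) / (q - 1)) * max_on S (degree G S)
               * (q - 1) `^ ((2 * q - p) / (q - 1)) in
  let M := fun t : R => max_on S (u^~ t) in
  [/\ (forall t : R, 0 < t -> t < T ->
         (lambda * (q - 1) * (T - t)) `^ (- (1 / (q - 1))) <= M t),
      (forall t : R, 0 < t -> t < T ->
         0 < lambda * (q - 1) * (T - t)
             - alpha * (T - t) `^ ((2 * q - p) / (q - 1)) ->
         M t <= (lambda * (q - 1) * (T - t)
                 - alpha * (T - t) `^ ((2 * q - p) / (q - 1)))
                `^ (- (1 / (q - 1))))
    & (T - t) `^ (1 / (q - 1)) * M t @[t --> T^'-]
        --> (1 / (lambda * (q - 1))) `^ (1 / (q - 1))].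
Proof.
move=> alpha M.
have [S0 _] := hS.
have [[_ su _] [x0 x0S blowup]] := hu.
have u0_ := solution_nonneg hmu hsigma hmusigma hlambda hq hu0 su.
have q0 : 0 < q - 1 by rewrite subr_gt0.
have lq0 : 0 < lambda * (q - 1) by exact: mulr_gt0.
pose g := (2 * q - p) / (q - 1); rewrite -/g.
pose d := (q - p + 1) / (q - 1).
have d0 : 0 < d by rewrite /d divr_gt0//; lra.
have gE : g = d + 1 by rewrite /g /d; field; rewrite gt_eqF.
pose D := max_on S (degree G S).
have alphaD : alpha = lambda `^ d * D * (q - 1) `^ g by [].
have hD : {in S, forall y, degree G S y <= D} by move=> y; exact: le_max_on.
have D0 : 0 <= D.
  by apply: le_trans (hD _ x0S); apply: sumr_ge0 => y _; exact: subweight_ge0.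
have lower t : 0 < t -> t < T ->
    (lambda * (q - 1) * (T - t)) `^ (- (1 / (q - 1))) <= M t.
  move=> t0 tT.
  have [y yS /le_trans] := blow_up_lower_bound hmu hsigma hmusigma hlambda hq
    su u0_ x0S blowup (ltW t0) tT.
  by apply; exact: le_max_on.
(* alpha (T-t)^g = (T-t) alpha (T-t)^d, which shows both the constant rate of
   the upper bound and that the correction is of lower order. *)
have factor t : t < T -> lambda * (q - 1) * (T - t) - alpha * (T - t) `^ g
    = (lambda * (q - 1) - alpha * (T - t) `^ d) * (T - t).
  move=> tT; have Tt : 0 < T - t by rewrite subr_gt0.
  rewrite gE powRD ?(gt_eqF Tt) ?implybT// powRr1 ?ltW//; ring.
have alphaE t : t < T -> lambda * (q - 1) - alpha * (T - t) `^ d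
    = (q - 1) * (lambda - D * (lambda * (q - 1) * (T - t)) `^ d).
  move=> tT; have Tt : 0 < T - t by rewrite subr_gt0.
  rewrite !powRM ?ltW// alphaD gE powRD ?(gt_eqF q0) ?implybT//.
  by rewrite powRr1 ?ltW//; ring.
have upper t : 0 < t -> t < T ->
    0 < lambda * (q - 1) * (T - t) - alpha * (T - t) `^ g ->
    M t <= (lambda * (q - 1) * (T - t) - alpha * (T - t) `^ g)
           `^ (- (1 / (q - 1))).
  move=> t0 tT; rewrite factor// alphaE// => pos.
  have Tt : 0 < T - t by rewrite subr_gt0.
  apply: max_on_le => //.
  apply: (blow_up_upper_bound hmu hsigma hmusigma hlambda hp hpq hq D0 hD su
    u0_ x0S blowup t0 tT).
  by move: pos; rewrite pmulr_lgt0// pmulr_rgt0.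
split=> //.
pose e := - (1 / (q - 1)).
have T0 : 0 < T by have [[]] := hu; rewrite lte_fin.
have limE : (1 / (lambda * (q - 1))) `^ (1 / (q - 1))
    = (lambda * (q - 1)) `^ e.
  by rewrite [1 / (lambda * _)]div1r -(powR_inv1 (ltW lq0)) -powRrM mulN1r.
have cdiff : lambda * (q - 1) - alpha * (T - t) `^ d @[t --> T^'-]
    --> lambda * (q - 1).
  rewrite -[X in _ --> X]subr0; apply: cvgB; first exact: cvg_cst.
  rewrite -(mulr0 alpha); apply: cvgMr.
  have -> : (fun t : R => (T - t) `^ d) = (fun x : R => x `^ d) \o (fun t => T - t) by [].
  apply: (@cvg_comp _ _ _ _ _ _ (0^'+)); last exact: powR_cvg0.
  move=> A [r /= r0 rA]; exists r => //= t Tt tT; apply: rA.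
    by rewrite /= sub0r normrN.
  by rewrite subr_gt0.
have scale t c : t < T -> 0 < c ->
    (T - t) `^ (1 / (q - 1)) * (c * (T - t)) `^ e = c `^ e.
  move=> tT c0; have Tt : 0 < T - t by rewrite subr_gt0.
  rewrite powRM ?ltW// mulrCA -powRD ?(gt_eqF Tt) ?implybT//.
  by rewrite subrr powRr0 mulr1.
have squeezed : \forall t \near T^'-, (lambda * (q - 1)) `^ e
    <= (T - t) `^ (1 / (q - 1)) * M t
    <= (lambda * (q - 1) - alpha * (T - t) `^ d) `^ e.
  near=> t.
  have t0 : 0 < t by near: t; exact: nbhs_left_gt.
  have tT : t < T by near: t; exact: nbhs_left_lt.
  have Tt : 0 < T - t by rewrite subr_gt0.
  have pos : 0 < lambda * (q - 1) - alpha * (T - t) `^ d.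
    by near: t; exact: (cvgr_gt _ cdiff).
  rewrite -{1}(scale t _ tT lq0) -(scale t _ tT pos) !ler_pM2l ?powR_gt0//.
  rewrite lower//= -factor// upper//.
  by rewrite factor// mulr_gt0.
rewrite limE; apply: (squeeze_cvgr squeezed); first exact: cvg_cst.
apply: (cvg_comp _ (fun x : R => x `^ e)); first exact: cdiff.
exact: continuous_powR_pos.
Unshelve. all: by end_near. Qed.
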